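(* Let $(X,d,\mu)$ be a geodesic metric measure space, let $\Omega\subset X$ be a domain, and let $p^*>p\geq 1$. Suppose that $M^{1,p}(\Omega)\hookrightarrow L^{p^*}(\Omega)$, i.e. there is a constant $C_e>0$ such that $\|u\|_{L^{p^*}(\Omega)}\le C_e\|u\|_{M^{1,p}(\Omega)}$ for all $u\in M^{1,p}(\Omega)$. Define $Q$ by $\frac1p-\frac1{p^*}=\frac1Q$. Then there exists a constant $b>0$ depending on $p$, $p^*$ and the embedding constant $C_e$ such that $$\mu(B(x,R)\cap\Omega)\geq bR^Q$$ holds for all $x\in\Omega$ and all $R\in(0,1]$.
   Context: A metric measure space $(X,d,\mu)$ is a metric space $(X,d)$ with a Borel regular measure $\mu$ such that every nonempty open set has positive measure and every bounded set has finite measure. No doubling condition is assumed. The space $X$ is geodesic if every pair of points in $X$ can be joined by a curve whose length equals the distance between the points. A domain is a nonempty open connected set. $B(x,R)$ denotes the ball with center $x$ and radius $R$ in $X$. Hajłasz–Sobolev space: let $S\subset X$ be measurable, $0<s<\infty$, $0<p\le\infty$. A nonnegative measurable function $g$ is an $s$-gradient of a measurable function $u$ in $S$ if there is a set $E\subset S$ with $\mu(E)=0$ such that $|u(x)-u(y)|\le d(x,y)^s(g(x)+g(y))$ for all $x,y\in S\setminus E$. Let $\mathcal D^s(u)$ be the collection of all $s$-gradients of $u$, and $\|u\|_{\dot M^{s,p}(S)}=\inf_{g\in\mathcal D^s(u)}\|g\|_{L^p(S)}$. The homogeneous space $\dot M^{s,p}(S)$ consists of the measurable $u$ for which this quantity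 is finite, and $M^{s,p}(S)=\dot M^{s,p}(S)\cap L^p(S)$ with norm $\|u\|_{M^{s,p}(S)}=\|u\|_{L^p(S)}+\|u\|_{\dot M^{s,p}(S)}$. Here $s=1$ and $S=\Omega$. *)

(* Defs.v *)
From HB Require Import structures.
From mathcomp Require Import all_boot all_order all_algebra.
From mathcomp Require Import all_classical all_reals all_analysis.

Set Implicit Arguments.
Unset Strict Implicit.
Unset Printing Implicit Defensive.

Import Order.TTheory GRing.Theory Num.Theory.
Import numFieldNormedType.Exports.

Local Open Scope classical_set_scope.
Local Open Scope ring_scope.

(* Nonempty metric spaces: the library attaches a sigma-algebra (here the one
   of Caratheodory-measurable sets) only to pointed types.  The chosen point
   plays no role. *)
#[short(type="pmetricType")]
HB.structure Definition PMetric (K : numDomainType) :=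
  { M of Metric K M & Pointed M }.

Section metric_spaces.
Context {R : realType}.

(* The partition a = t_0 < ... < t_n = b is given by s = [:: t_1; ...; t_n],
   as in the library's real-valued [variation]. *)
Definition curve_length (X : metricType R) (a b : R) (gamma : R -> X) : \bar R :=
  ereal_sup [set (\sum_(0 <= i < size s)
      mdist (gamma (nth b (a :: s) i)) (gamma (nth b (a :: s) i.+1)))%:E
    | s in itv_partition a b].

Definition geodesic (X : metricType R) : Prop :=
  forall x y : X, exists (a b : R) (gamma : R -> X),
    [/\ a <= b, {within `[a, b], continuous gamma}, gamma a = x, gamma b = y &
        curve_length a b gamma = (mdist x y)%:E].

Definition metric_bounded (X : metricType R) (A : set X) : Prop :=
  exists M : R, forall x y, A x -> A y -> mdist x y <= M.

Definition domain (X : metricType R) (Omega : set X) : Prop :=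
  [/\ Omega !=set0, open Omega & connected Omega].

(* A Borel regular measure is, as usual in analysis on metric spaces, an outer
   measure defined on all subsets of X. *)
Definition borel_regular (X : metricType R)
    (mu : {outer_measure set X -> \bar R}) : Prop :=
  (forall B, <<s open >> B -> mu.-caratheodory B) /\
  (forall A, exists B, [/\ <<s open >> B, A `<=` B & mu B = mu A]).

Definition metric_measure_space (X : metricType R)
    (mu : {outer_measure set X -> \bar R}) : Prop :=
  [/\ borel_regular mu,
      forall U, open U -> U !=set0 -> (0 < mu U)%E &
      forall A, metric_bounded A -> (mu A < +oo)%E].

End metric_spaces.

Section hajlasz_sobolev.
Context {R : realType} {X : pmetricType R}.
Variable mu : {outer_measure set X -> \bar R}.
Local Notation Xmu := (caratheodory_type mu).

(* Functions on S are represented by functions on X whose values outside S are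
   irrelevant. *)
Definition Lp_norm (S : set X) (p : \bar R) (f : X -> R) : \bar R :=
  Lnorm (mu : {measure set Xmu -> \bar R}) p (EFin \o (f \_ S)).

Definition s_gradient (s : R) (S : set X) (u g : X -> R) : Prop :=
  [/\ measurable_fun (S : set Xmu) (g : Xmu -> R),
      forall x, S x -> 0 <= g x &
      exists E : set X, [/\ E `<=` S, mu E = 0%E &
        forall x y, (S `\` E) x -> (S `\` E) y ->
          `|u x - u y| <= mdist x y `^ s * (g x + g y)]].

Definition hom_hajlasz_norm (s : R) (p : \bar R) (S : set X) (u : X -> R) : \bar R :=
  ereal_inf [set Lp_norm S p g | g in s_gradient s S u].

Definition hajlasz_norm (s : R) (p : \bar R) (S : set X) (u : X -> R) : \bar R :=
  (Lp_norm S p u + hom_hajlasz_norm s p S u)%E.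

Definition hom_hajlasz_space (s : R) (p : \bar R) (S : set X) : set (X -> R) :=
  [set u | measurable_fun (S : set Xmu) (u : Xmu -> R) /\
           (hom_hajlasz_norm s p S u < +oo)%E].

Definition Lp_space (p : \bar R) (S : set X) : set (X -> R) :=
  [set u | measurable_fun (S : set Xmu) (u : Xmu -> R) /\
           (Lp_norm S p u < +oo)%E].

Definition hajlasz_space (s : R) (p : \bar R) (S : set X) : set (X -> R) :=
  hom_hajlasz_space s p S `&` Lp_space p S.

End hajlasz_sobolev.

(* Main.v *)
Require Import Defs.
From HB Require Import structures.
From mathcomp Require Import all_boot all_order all_algebra.
From mathcomp Require Import all_classical all_reals all_analysis.
From mathcomp Require Import measurable_realfun ring lra.

Set Implicit Arguments.
Unset Strict Implicit.
Unset Printing Implicit Defensive.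

Import Order.TTheory GRing.Theory Num.Theory.
Import numFieldNormedType.Exports.

Local Open Scope classical_set_scope.
Local Open Scope ring_scope.

(** Fix [x] in [Omega] and let [phi t] be the measure of [ball x t `&` Omega].
For [s < t], test the embedding on the Lipschitz cutoff equal to [1] on
[ball x s] and to [0] off [ball x t]. The indicator of [ball x t] divided by
[t - s] is a 1-gradient of it, so the embedding becomes ([sobolev_ball_step])

  [phi s `^ ps^-1 <= Ce * (1 + (t - s)^-1) * phi t `^ p^-1].

Since [p < ps], the exponent on the right is the larger one, so smallness of
[phi] improves when the radius shrinks, as in De Giorgi's iteration. Put
[t_j = r / 2 ^+ j] and apply the inequality along the radii
[r / 2 + t_j / 2], which decrease from [r] to [r / 2] with gaps [t_j / 4].
The relation between [p], [ps] and [Q] is what makes the bound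
[phi (r / 2 + t_j / 2) <= b * t_j `^ Q] reproduce itself with the same [b]
([halving_iteration]).

If the measure of [ball x r `&` Omega] were below [b * r `^ Q], the bound would
therefore hold for all [j] and force [phi (r / 2) = 0]. But
[ball x (r / 2) `&` Omega] is open and nonempty, hence of positive measure.
The comparison radius is [r / 2] rather than one at which [phi] drops to half
of its value, because spheres may have positive measure and such a radius need
not exist. *)

(** * Real inequalities *)

Section real_analysis.
Context {R : realType}.
Implicit Types p ps Q C r a b : R.

(** The number [b] with [5 * C * b `^ Q^-1 = 2 `^ (- (Q / ps))]: the left side
is the factor picked up by one step of the iteration, the right side the factor
lost when the bound at scale [t / 2] replaces the one at scale [t]. *)
Definition volume_constant ps Q C : R := (2 `^ (- (Q / ps)) / (5 * C)) `^ Q.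

Lemma volume_constant_gt0 ps Q C : 0 < C -> 0 < volume_constant ps Q C.
Proof. by move=> C0; rewrite powR_gt0// divr_gt0 ?powR_gt0// mulr_gt0. Qed.

(** The induction closes because [p^-1 = Q^-1 + ps^-1]. At scale [t], the
inductive bound contributes [t `^ (Q / p) = t * t `^ (Q / ps)], whose extra
factor [t] cancels the factor [5 / t] of the step; likewise
[b `^ p^-1 = b `^ Q^-1 * b `^ ps^-1], whose factor [b `^ Q^-1] absorbs the
constants. *)
Lemma halving_iteration p ps Q C r (phi : R -> R) :
    0 < p -> 0 < ps -> 0 < Q -> p^-1 - ps^-1 = Q^-1 -> 0 < C -> 0 < r <= 1 ->
    (forall t, 0 <= phi t) ->
    (forall s t, 0 < s < t ->
      phi s `^ ps^-1 <= C * (1 + (t - s)^-1) * phi t `^ p^-1) ->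
    phi r <= volume_constant ps Q C * r `^ Q ->
  forall j, phi (r / 2 + r / 2 ^+ j / 2)
              <= volume_constant ps Q C * (r / 2 ^+ j) `^ Q.
Proof.
move=> p0 ps0 Q0 pQ C0 /andP[r0 r1] phi0 step phir.
have b0 := volume_constant_gt0 ps Q C0.
have bV : volume_constant ps Q C `^ Q^-1 = 2 `^ (- (Q / ps)) / (5 * C).
  rewrite -powRrM mulfV ?gt_eqF// powRr1//.
  by rewrite divr_ge0 ?powR_ge0// mulr_ge0// ltW.
move: (volume_constant ps Q C) => b in phir b0 bV *.
elim=> [|j IH]; first by rewrite expr0 divr1 -splitr.
rewrite exprS invfM (mulrCA r) (mulrC 2^-1 (r / _)).
set t := r / 2 ^+ j in IH *.
have t0 : 0 < t by rewrite divr_gt0// exprn_gt0.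
have t1 : t <= 1.
  by rewrite ler_pdivrMr ?exprn_gt0// mul1r (le_trans r1)// exprn_ege1// ler1n.
suff: phi (r / 2 + t / 2 / 2) `^ ps^-1 <= (b * (t / 2) `^ Q) `^ ps^-1.
  move/(@ge0_ler_powR _ ps (ltW ps0)).
  rewrite !nnegrE !powR_ge0 => /(_ isT isT).
  rewrite -!powRrM mulVf ?gt_eqF// !powRr1// mulr_ge0 ?powR_ge0//; exact: ltW.
have st : 0 < r / 2 + t / 2 / 2 < r / 2 + t / 2 by apply/andP; split; lra.
apply: le_trans (step _ _ st) _.
have -> : r / 2 + t / 2 - (r / 2 + t / 2 / 2) = t / 4 by field.
(* The hypothesis r <= 1 enters here: the zero-order term 1 is at most 1 / t. *)
have dt : 1 + (t / 4)^-1 <= 5 / t.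
  rewrite invf_div -(@ler_pM2r _ t)// mulrDl !mulfVK ?gt_eqF//; lra.
apply: (@le_trans _ _ (C * (5 / t) * (b * t `^ Q) `^ p^-1)).
  apply: ler_pM.
  - by rewrite mulr_ge0 ?addr_ge0// ?invr_ge0 ?divr_ge0// ltW.
  - exact: powR_ge0.
  - by rewrite ler_pM2l.
  apply: ge0_ler_powR => //; rewrite ?nnegrE ?invr_ge0 ?mulr_ge0 ?powR_ge0//;
    exact: ltW.
have pE : p^-1 = Q^-1 + ps^-1 by rewrite -pQ subrK.
move: t t0 {IH t1 st dt} => t t0.
rewrite !powRM ?mulr_ge0 ?powR_ge0 ?invr_ge0 ?(ltW b0) ?(ltW t0)//.
rewrite -!powRrM {1 2}pE mulrDr mulfV ?gt_eqF//.
rewrite !powRD ?(gt_eqF b0) ?(gt_eqF t0) ?implybT//.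
rewrite bV powRr1 ?(ltW t0)// powRN.
rewrite -[2^-1]powR_inv1// -(powRrM 2 (-1)) mulN1r powRN.
have tQ : 0 < 2 `^ (Q / ps) :> R by rewrite powR_gt0.
rewrite le_eqVlt; apply/orP; left; apply/eqP; field.
by rewrite !gt_eqF.
Qed.

Lemma powR_halving_small b Q r e : 0 < b -> 0 < Q -> 0 < r -> 0 < e ->
  exists j, b * (r / 2 ^+ j) `^ Q < e.
Proof.
move=> b0 Q0 r0 e0; set d := (e / b) `^ Q^-1.
have d0 : 0 < d by rewrite powR_gt0// divr_gt0.
exists (Num.bound (r / d)).
have rd : r / 2 ^+ Num.bound (r / d) < d.
  rewrite ltr_pdivrMr ?exprn_gt0// mulrC -ltr_pdivrMr//.
  apply: lt_trans (archi_boundP _) _; first by rewrite divr_ge0// ltW.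
  by rewrite -natrX ltr_nat ltn_expl.
rewrite mulrC -ltr_pdivlMr//.
have -> : e / b = d `^ Q.
  by rewrite -powRrM mulVf ?gt_eqF// powRr1// divr_ge0// ltW.
apply: gt0_ltr_powR => //; rewrite nnegrE ?divr_ge0 ?exprn_ge0//; exact: ltW.
Qed.

Definition clip01 a := Num.min 1 (Num.max 0 a).

Lemma clip01_ge0 a : 0 <= clip01 a.
Proof. by rewrite /clip01 le_min ler01 le_max lexx. Qed.

Lemma clip01_le1 a : clip01 a <= 1.
Proof. by rewrite /clip01 ge_min lexx. Qed.

Lemma clip01_eq0 a : a <= 0 -> clip01 a = 0.
Proof. by move=> a0; rewrite /clip01 max_l// min_r. Qed.

Lemma clip01_eq1 a : 1 <= a -> clip01 a = 1.
Proof. by move=> a0; rewrite /clip01 max_r ?(le_trans ler01)// min_l. Qed.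

Lemma clip01_nonexpansive a b : `|clip01 a - clip01 b| <= `|a - b|.
Proof.
rewrite ler_norml /clip01 /Num.min /Num.max.
do ! case: ifPn; rewrite -?leNgt => *;
have := ler_norm (a - b); have := ler_norm (b - a); rewrite (distrC b); lra.
Qed.
End real_analysis.

(** * Measurability and Lp norms *)

Section hajlasz_toolbox.
Context {R : realType} {X : pmetricType R}.
Variable mu : {outer_measure set X -> \bar R}.
Local Notation Xmu := (caratheodory_type mu).

Lemma open_metric_ball (x : X) (r : R) : open (ball x r).
Proof.
rewrite openE => y; rewrite /interior ballEmdist /= => xy.
apply/nbhs_ballP; exists (r - mdist x y) => /=; first by rewrite subr_gt0.
move=> z; rewrite ballEmdist /= ltrBrDl; apply: le_lt_trans.
exact: metric_triangle.
Qed.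

Lemma measurable_ball_mdist : borel_regular mu -> forall (x : X) (r : R),
  measurable (ball x r : set Xmu).
Proof.
move=> [bc _] x r; apply: bc; apply: sub_sigma_algebra.
exact: open_metric_ball.
Qed.

(** The sublevel sets of [mdist x] are balls. *)
Lemma measurable_mdist : borel_regular mu -> forall x : X,
  measurable_fun [set: Xmu] (fun y : Xmu => mdist x y : R).
Proof.
move=> bc x mD.
apply: (measurability _ (RGenInftyO.measurableE R)) => //.
move=> _ [_ [a ->] <-]; rewrite setTI.
have := measurable_ball_mdist bc x a; rewrite ballEmdist.
by congr (measurable _); apply/seteqP; split => y /=; rewrite in_itv.
Qed.

Lemma Lp_norm_le (S : set X) (p : R) (u v : X -> R) :
    0 <= p -> measurable (S : set Xmu) ->
    measurable_fun (S : set Xmu) (u : Xmu -> R) ->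
    measurable_fun (S : set Xmu) (v : Xmu -> R) ->
    (forall y, S y -> `|u y| <= `|v y|) ->
  (Lp_norm mu S p%:E u <= Lp_norm mu S p%:E v)%E.
Proof.
move=> p0 mS mu' mv uv.
have mf (w : Xmu -> R) : measurable_fun (S : set Xmu) w ->
    measurable_fun [set: Xmu] (fun y : Xmu => (`|(w \_ S) y| `^ p)%:E).
  move=> mw; apply/measurable_EFinP.
  apply: (measurableT_comp (measurable_powR p)); apply: measurableT_comp => //.
  exact/(measurable_restrictT _ mS).
rewrite /Lp_norm unlock /=; apply: gt0_ler_poweR.
- by rewrite invr_ge0.
- rewrite in_itv/= leey andbT.
  by apply: integral_ge0 => y _; rewrite lee_fin powR_ge0.
- rewrite in_itv/= leey andbT.
  by apply: integral_ge0 => y _; rewrite lee_fin powR_ge0.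
apply: ge0_le_integral => //.
- exact: (mf u).
- exact: (mf v).
move=> y _; rewrite lee_fin; apply: ge0_ler_powR; rewrite ?nnegrE//.
by rewrite !patchE; case: ifPn => // /set_mem; exact: uv.
Qed.

Lemma Lp_norm_scaled_indic (S A : set X) (p c : R) : 0 < p -> 0 <= c ->
    measurable (S : set Xmu) -> measurable (A : set Xmu) ->
  (Lp_norm mu S p%:E (fun y => c * \1_A y)%R = c%:E * mu (A `&` S) `^ p^-1)%E.
Proof.
move=> p0 c0 mS mA; rewrite /Lp_norm unlock /=.
have mAS : measurable (A `&` S : set Xmu) by exact: measurableI.
transitivity ((\int[mu : {measure set Xmu -> \bar R}]_y
    ((c `^ p)%:E * (\1_(A `&` S) y)%:E)) `^ p^-1)%E.
  congr (_ `^ _)%E; apply: eq_integral => y _.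
  rewrite -EFinM patchE indicI /=; congr EFin.
  rewrite !indicE; case: (y \in S); last first.
    by rewrite mulr0n !mulr0 normr0 powR0 ?gt_eqF.
  rewrite mulr1 normrM powRM// ger0_norm//; congr (_ * _).
  by case: (y \in A); rewrite ?normr1 ?powR1 ?normr0 ?powR0 ?gt_eqF.
rewrite ge0_integralZl_EFin ?powR_ge0//; last exact/measurable_EFinP.
rewrite integral_indic// setIT poweRM ?lee_fin ?powR_ge0//.
by rewrite poweR_EFin -powRrM mulfV ?gt_eqF// powRr1.
Qed.

(** * Cutoff functions and the embedding on balls *)

Definition cutoff (x : X) (s t : R) (y : X) : R :=
  clip01 ((t - mdist x y) / (t - s)).

Lemma measurable_cutoff (S : set X) (x : X) (s t : R) :
    borel_regular mu -> measurable (S : set Xmu) ->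
  measurable_fun (S : set Xmu) (cutoff x s t : Xmu -> R).
Proof.
move=> bmu mS; apply: measurable_minr => //; apply: measurable_maxr => //.
apply: measurable_funM => //; apply: measurable_funB => //.
by apply: measurable_funTS; exact: measurable_mdist.
Qed.

Lemma cutoff_out (x : X) (s t : R) (y : X) : s < t ->
  ~ ball x t y -> cutoff x s t y = 0.
Proof.
rewrite ballEmdist /= => st /negP; rewrite -leNgt => ty; apply: clip01_eq0.
by rewrite pmulr_lle0 ?invr_gt0 ?subr_gt0// subr_le0.
Qed.

Lemma cutoff_in (x : X) (s t : R) (y : X) : s < t ->
  ball x s y -> cutoff x s t y = 1.
Proof.
rewrite ballEmdist /= => st sy; apply: clip01_eq1.
by rewrite ler_pdivlMr ?subr_gt0// mul1r lerB// ltW.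
Qed.

Lemma cutoff_lipschitz (x : X) (s t : R) (y z : X) : s < t ->
  `|cutoff x s t y - cutoff x s t z| <= mdist y z / (t - s).
Proof.
move=> st; apply: le_trans (clip01_nonexpansive _ _) _.
have ts : 0 < t - s by rewrite subr_gt0.
rewrite -mulrBl normrM normfV (gtr0_norm ts) ler_pM2r ?invr_gt0//.
rewrite ler_norml.
have := metric_triangle x y z; have := metric_triangle x z y.
rewrite (metric_sym z y); lra.
Qed.

(** When one of the two points lies in [ball x t], its value of the gradient
alone already dominates the Lipschitz constant; when neither does, the cutoff
vanishes at both. *)
Lemma s_gradient_cutoff (S : set X) (x : X) (s t : R) :
    borel_regular mu -> measurable (S : set Xmu) -> s < t ->
  s_gradient mu 1 S (cutoff x s t) (fun y => (t - s)^-1 * \1_(ball x t) y).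
Proof.
move=> bmu mS st; have ts : 0 < (t - s)^-1 by rewrite invr_gt0 subr_gt0.
have g0 y : 0 <= (t - s)^-1 * \1_(ball x t) y by rewrite mulr_ge0// ltW.
split=> //.
  apply: measurable_funM => //; apply: measurable_funTS.
  apply/measurable_indicP.
  exact: measurable_ball_mdist.
exists set0; split; [exact: sub0set|exact: outer_measure0|].
move=> y z _ _; rewrite powRr1 ?mdist_ge0//.
have [[ty tz]|yz] := pselect (~ ball x t y /\ ~ ball x t z).
  by rewrite !cutoff_out// subrr normr0 mulr_ge0 ?mdist_ge0 ?addr_ge0.
apply: le_trans (cutoff_lipschitz _ _ _ st) _.
apply: ler_wpM2l; first exact: mdist_ge0.
have [ty|ty] := pselect (ball x t y).
  by rewrite indicE mem_set// mulr1 lerDl.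
have [tz|tz] := pselect (ball x t z); last by case: yz.
by rewrite [X in _ + _ * X]indicE mem_set// mulr1 lerDr.
Qed.

(** Pointwise, the cutoff lies between the indicators of the two balls. So the
smaller ball bounds its [ps]-norm from below and the larger one bounds its
[p]-norm from above, while the [p]-norm of the gradient is computed exactly. *)
Lemma sobolev_ball_step (Omega : set X) (p ps Ce : R) :
    borel_regular mu -> measurable (Omega : set Xmu) -> 0 < p -> 0 < ps ->
    0 < Ce ->
    (forall u : X -> R, hajlasz_space mu 1 p%:E Omega u ->
       (Lp_norm mu Omega ps%:E u <= Ce%:E * hajlasz_norm mu 1 p%:E Omega u)%E) ->
  forall (x : X) (s t : R), s < t ->
    mu (ball x s `&` Omega) \is a fin_num ->
    mu (ball x t `&` Omega) \is a fin_num ->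
  fine (mu (ball x s `&` Omega)) `^ ps^-1 <=
    Ce * (1 + (t - s)^-1) * fine (mu (ball x t `&` Omega)) `^ p^-1.
Proof.
move=> bmu mO p0 ps0 Ce0 emb x s t st fs ft.
have mball r : measurable (ball x r : set Xmu) by exact: measurable_ball_mdist.
have mind r : measurable_fun (Omega : set Xmu)
    ((fun y => 1 * \1_(ball x r) y) : Xmu -> R).
  exact: measurable_funM.
have mcut := measurable_cutoff x s t bmu mO.
have st0 : 0 <= (t - s)^-1 by rewrite invr_ge0 subr_ge0 ltW.
set M := fine (mu (ball x t `&` Omega)) `^ p^-1.
have Lpu : (Lp_norm mu Omega p%:E (cutoff x s t) <= M%:E)%E.
  apply: (@le_trans _ _ (Lp_norm mu Omega p%:E (fun y => 1 * \1_(ball x t) y))).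
    apply: Lp_norm_le => //; first exact: ltW.
    move=> y _; have [ty|ty] := pselect (ball x t y).
      rewrite indicE mem_set// mulr1 normr1 ger0_norm ?clip01_le1//.
      exact: clip01_ge0.
    by rewrite cutoff_out// normr0.
  by rewrite Lp_norm_scaled_indic// mul1e -(fineK ft) poweR_EFin.
have homu : (hom_hajlasz_norm mu 1 p%:E Omega (cutoff x s t)
    <= ((t - s)^-1 * M)%:E)%E.
  rewrite EFinM -poweR_EFin fineK// -Lp_norm_scaled_indic//.
  apply: ereal_inf_lbound.
  exists (fun y => (t - s)^-1 * \1_(ball x t) y) => //.
  exact: s_gradient_cutoff.
have usp : hajlasz_space mu 1 p%:E Omega (cutoff x s t).
  by split; split => //; [exact: le_lt_trans homu (ltry _)
                         |exact: le_lt_trans Lpu (ltry _)].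
rewrite -lee_fin.
apply: (@le_trans _ _ (Lp_norm mu Omega ps%:E (cutoff x s t))).
  rewrite -poweR_EFin fineK// -[leLHS]mul1e -Lp_norm_scaled_indic//.
  apply: Lp_norm_le => //; first exact: ltW.
  move=> y _; have [sy|sy] := pselect (ball x s y).
    by rewrite cutoff_in// indicE mem_set// mulr1.
  by rewrite indicE memNset// mulr0 normr0.
apply: le_trans (emb _ usp) _.
rewrite -mulrA EFinM lee_pmul2l// mulrDl mul1r EFinD.
exact: leeD.
Qed.

End hajlasz_toolbox.

(** * The lower volume bound *)

Theorem theorem2p4 (R : realType) (p ps Q Ce : R)
    (hp : 1 <= p) (hps : p < ps) (hQ : p^-1 - ps^-1 = Q^-1) (hCe : 0 < Ce) :
  exists b : R, 0 < b /\
    forall (X : pmetricType R) (mu : {outer_measure set X -> \bar R})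
      (Omega : set X),
      metric_measure_space mu ->
      geodesic X ->
      domain Omega ->
      (forall u : X -> R, hajlasz_space mu 1 p%:E Omega u ->
         (Lp_norm mu Omega ps%:E u
            <= Ce%:E * hajlasz_norm mu 1 p%:E Omega u)%E) ->
      forall (x : X) (r : R), Omega x -> 0 < r -> r <= 1 ->
        ((b * r `^ Q)%:E <= mu (ball x r `&` Omega))%E.
Proof.
have p0 : 0 < p by exact: lt_le_trans hp.
have ps0 : 0 < ps by exact: lt_trans hps.
have Q0 : 0 < Q by rewrite -invr_gt0 -hQ subr_gt0 ltf_pV2.
exists (volume_constant ps Q Ce); split; first exact: volume_constant_gt0.
move=> X mu Omega [bmu openpos bddfin] _ [_ oO _] emb x r xO r0 r1.
have mO : measurable (Omega : set (caratheodory_type mu)).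
  by apply: bmu.1; exact: sub_sigma_algebra.
have finB t : mu (ball x t `&` Omega) \is a fin_num.
  rewrite ge0_fin_numE ?outer_measure_ge0//; apply: bddfin.
  exists (t + t) => y z [+ _] [+ _]; rewrite ballEmdist /= => xy xz.
  apply: le_trans (metric_triangle y x z) _.
  by rewrite (metric_sym y x) lerD// ltW.
rewrite leNgt; apply/negP => small.
pose phi t := fine (mu (ball x t `&` Omega)).
have phi_ge0 t : 0 <= phi t by rewrite fine_ge0 ?outer_measure_ge0.
have phi_mono s t : s <= t -> phi s <= phi t.
  move=> st; apply: fine_le => //; apply: le_outer_measure; apply: setSI.
  exact: le_ball.
have phi_pos : 0 < phi (r / 2).
  rewrite fine_gt0// ltey_eq finB/= andbT; apply: openpos.
    by apply: openI => //; exact: open_metric_ball.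
  by exists x; split => //; apply: ballxx; rewrite divr_gt0.
have phir : phi r <= volume_constant ps Q Ce * r `^ Q.
  by rewrite -lee_fin fineK// ltW.
have r01 : 0 < r <= 1 by rewrite r0.
have step s t : 0 < s < t ->
    phi s `^ ps^-1 <= Ce * (1 + (t - s)^-1) * phi t `^ p^-1.
  by move=> /andP[_ st]; exact: sobolev_ball_step.
have decay := halving_iteration p0 ps0 Q0 hQ hCe r01 phi_ge0 step phir.
have [j] := powR_halving_small (volume_constant_gt0 ps Q hCe) Q0 r0 phi_pos.
rewrite ltNge (le_trans _ (decay j))// phi_mono// lerDl.
by rewrite !divr_ge0 ?exprn_ge0// ltW.
Qed.
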